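(* Let $n\ge 2$ and let $f$ be a self-dual Hecke--Maass form for $SL(n,\mathbb{Z})$, normalized by $A(1,\dots,1)=1$, with Satake parameters $\alpha_{p,i}$ ($p$ prime, $1\le i\le n$), and let $a_f(p^r)=\sum_{i=1}^n\alpha_{p,i}^r$. Suppose that Ramanujan's generalized weak conjecture holds for $f$, i.e. there is some (small) $\epsilon_1>0$ such that $$|\alpha_{p,i}|\le p^{\frac14-\epsilon_1}\qquad\text{for every prime } p \text{ and every } i=1,\dots,n.$$ Then the Rudnick--Sarnak conjecture holds for $f$, i.e. for every fixed integer $r\ge 2$, $$\sum_p\frac{|a_f(p^r)|^2(\log p)^2}{p^r}<\infty,$$ where the sum is over all primes $p$.
   Context: **Hecke--Maass forms.** Let $n\ge2$ and $\mathcal{H}^n=GL(n,\mathbb{R})/(O(n,\mathbb{R})\cdot\mathbb{R}^\times)$ be the generalized upper half plane, with coordinates $z=xy$, $x$ upper triangular unipotent, $y=\mathrm{diag}(y_1\cdots y_{n-1},\dots,y_1,1)$, $y_i>0$. For $v=(v_1,\dots,v_{n-1})\in\mathbb{C}^{n-1}$ put $I_v(z)=\prod_{i,j=1}^{n-1}y_i^{b_{ij}v_j}$, where $b_{ij}=ij$ if $i+j\le n$ and $b_{ij}=(n-i)(n-j)$ if $i+j\ge n$. A Maass form of type $v$ for $SL(n,\mathbb{Z})$ is a smooth $f\in\mathcal{L}^2(SL(n,\mathbb{Z})\backslash\mathcal{H}^n)$ such that: (1) $f(\gamma z)=f(z)$ for all $\gamma\in SL(n,\mathbb{Z})$; (2)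 $Df=\lambda_Df$ for all $D$ in the center of the universal enveloping algebra of $\mathfrak{gl}(n,\mathbb{R})$, with $\lambda_D$ the eigenvalue of $D$ on $I_v$; (3) $\int_{(SL(n,\mathbb{Z})\cap U)\backslash U}f(uz)\,du=0$ for every group $U$ of block upper triangular matrices with diagonal blocks $I_{r_1},\dots,I_{r_b}$, $r_1+\dots+r_b=n$ (nontrivial $U$). A Hecke--Maass form is a Maass form that is an eigenfunction of all Hecke operators. **Fourier coefficients.** $f$ has the expansion $$f(z)=\sum_{\gamma\in U_{n-1}(\mathbb{Z})\backslash SL(n-1,\mathbb{Z})}\ \sum_{m_1,\dots,m_{n-2}\ge1}\ \sum_{m_{n-1}\ne0}\frac{A(m_1,\dots,m_{n-1})}{\prod_{j=1}^{n-1}|m_j|^{j(n-j)/2}}\,W_J\!\left(M\begin{pmatrix}\gamma&\\&1\end{pmatrix}z,\,v,\,\psi_{1,\dots,1,m_{n-1}/|m_{n-1}|}\right),$$ with $M=\mathrm{diag}(m_1\cdots m_{n-2}|m_{n-1}|,\dots,m_1m_2,m_1,1)$, $U_{k}$ the group of upper triangular unipotent $k\times k$ matrices, $\psi_{1,\dots,1,\epsilon}(u)=e^{2\pi i(u_1+\cdots+u_{n-2}+\epsilon u_{n-1})}$ where $u_{n-1},\dots,u_1$ are the superdiagonal entries of $u$ from top to bottom, and $W_J(z,v,\psi)=\int_{U_n(\mathbb{R})}I_v(wuz)\overline{\psi(u)}\,du$ (analytically continued) the Jacquet Whittaker function; here $w$ is the antidiagonal matrix with entries $1$ except for the top-right entry,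 which is $(-1)^{[n/2]}$. The normalization is $A(1,\dots,1)=1$. **Self-duality.** The dual form is $\tilde f(z)=f(w\,(z^{-1})^T w)$; its coefficients are $A(m_{n-1},\dots,m_1)=\overline{A(m_1,\dots,m_{n-1})}$. $f$ is self-dual if $\tilde f=f$. **Satake parameters.** For each prime $p$, $\alpha_{p,1},\dots,\alpha_{p,n}$ are the complex roots of $$X^n+\sum_{j=1}^{n-1}(-1)^jA(1,\dots,1,p,1,\dots,1)X^{n-j}+(-1)^n,$$ with $p$ in the $j$-th position in the $j$-th term. *)

(* Defs.v *)
From HB Require Import structures.
From mathcomp Require Import all_boot all_order all_algebra.
From mathcomp Require Import all_classical all_reals all_analysis.
From mathcomp Require Import complex.
From mathcomp.analysis.showcase Require summability.

Set Implicit Arguments.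
Unset Strict Implicit.
Unset Printing Implicit Defensive.

Import Order.TTheory GRing.Theory Num.Theory.
Import numFieldNormedType.Exports.

Local Open Scope classical_set_scope.
Local Open Scope ring_scope.
Local Open Scope complex_scope.

(* Conventions.
   - Indices are 0-based: entry j : 'I_n.-1 of a row vector is the coordinate
     written with index j.+1 on paper (y_1, ..., y_{n-1}; v_1, ..., v_{n-1};
     m_1, ..., m_{n-1}).
   - A function on H^n = GL(n,R) / (O(n,R) R^x) is a function on 'M[R]_n whose
     restriction to the invertible matrices is invariant under right
     multiplication by O(n,R) and by nonzero scalars; its values at singular
     matrices are never used. *)

Section ComplexNumbers.
Variable R : realType.

Definition cabs (z : R[i]) : R := Normc.normc z.

Definition expi (t : R) : R[i] := cos t +i* sin t.

(* y ^ s = exp (s log y); meaningful for y > 0 *)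
Definition cpow (y : R) (s : R[i]) : R[i] :=
  (y `^ complex.Re s)%:C * expi (complex.Im s * ln y).

(* unconditional sum of the family F over the index set D *)
Definition has_sum (I : choiceType) (D : set I) (F : I -> R[i]) (s : R[i]) :=
  summability.partial_sum (fun i => if i \in D then F i : R[i]^o else 0)
    @ summability.totally --> (s : R[i]^o).

End ComplexNumbers.

Section IteratedIntegrals.
Variables (R : realType) (I : eqType).

(* Lebesgue integral of F over the coordinates listed in s, each running over
   D, the remaining coordinates being frozen to their values in c *)
Fixpoint iterint (D : set R) (s : seq I) (F : (I -> R) -> \bar R)
    (c : I -> R) : \bar R :=
  if s is i :: s' then
    (\int[@lebesgue_measure R]_(t in D)
       iterint D s' F (fun k => if k == i then t else c k))%E
  else F c.

Definition citerint (D : set R) (s : seq I) (F : (I -> R) -> R[i])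
    (c : I -> R) : R[i] :=
  fine (iterint D s (fun x => (complex.Re (F x))%:E) c) +i*
  fine (iterint D s (fun x => (complex.Im (F x))%:E) c).

End IteratedIntegrals.

Section Groups.

Definition SLZ (n : nat) : set 'M[int]_n := [set g | \det g = 1].

Definition upper_unipotent (K : nzRingType) (n : nat) : set 'M[K]_n :=
  [set u | forall i j : 'I_n, (j <= i)%N -> u i j = (i == j)%:R].

Definition intmx (R : realType) (m n : nat) (g : 'M[int]_(m, n)) : 'M[R]_(m, n) :=
  map_mx (fun k : int => k%:~R) g.

(* the block matrix diag(g, 1) *)
Definition corner_mx (n : nat) (g : 'M[int]_n.-1) : 'M[int]_n :=
  \matrix_(i, j)
    match insub (i : nat), insub (j : nat) with
    | Some a, Some b => g a b
    | _, _ => (i == j)%:R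
    end.

(* T is a set of representatives of U_k(Z) \ SL(k,Z) *)
Definition U_SL_transversal (k : nat) (T : set 'M[int]_k) :=
  T `<=` @SLZ k /\
  forall g, @SLZ k g ->
    exists! t, T t /\ exists2 u, @upper_unipotent int k u & g = u *m t.

(* s lists, without repetition, representatives of
   SL(n,Z) \ SL(n,Z) d SL(n,Z) *)
Definition hecke_reps (n : nat) (d : 'M[int]_n) (s : seq 'M[int]_n) :=
  let dbl := [set g | exists a b, [/\ SLZ a, SLZ b & g = a *m d *m b]] in
  [/\ uniq s,
      (forall c, c \in s -> dbl c) &
      (forall g, dbl g ->
         exists! c, c \in s /\ exists2 a, SLZ a & g = a *m c)].

End Groups.

Section UpperHalfSpace.
Variables (R : realType) (n : nat).

Definition orthogonal : set 'M[R]_n := [set k | k *m k^T = 1%:M].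

(* g and z represent the same point of H^n *)
Definition same_point (z g : 'M[R]_n) :=
  exists k c, [/\ orthogonal k, c != 0 & g = c *: (z *m k)].

(* diag(y_1 ... y_{n-1}, ..., y_1 y_2, y_1, 1) *)
Definition ydiag (y : 'rV[R]_n.-1) : 'M[R]_n :=
  diag_mx (\row_(i < n) \prod_(k < n.-1 | (k + i < n.-1)%N) y 0 k).

(* the positions of the strictly upper triangular entries *)
Definition upos : seq ('I_n * 'I_n) :=
  [seq p : 'I_n * 'I_n <- enum {: 'I_n * 'I_n} | (p.1 < p.2)%N].

(* the unipotent matrix with entry c (i, j) at (i, j) for i <> j *)
Definition umx (c : 'I_n * 'I_n -> R) : 'M[R]_n :=
  \matrix_(i, j) if i == j then 1 else c (i, j).

(* the y-coordinates in the Iwasawa decomposition g = x y k c, with k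
   orthogonal and c a nonzero scalar *)
Definition iwasawa_y (g : 'M[R]_n) : 'rV[R]_n.-1 :=
  get [set y : 'rV[R]_n.-1 | (forall k, 0 < y 0 k) /\
    exists2 x, @upper_unipotent R n x & same_point (x *m ydiag y) g].

(* b_{ij} for 1-based i and j *)
Definition bcoef (i j : nat) : nat :=
  if (i + j <= n)%N then (i * j)%N else ((n - i) * (n - j))%N.

Definition Ifun (v : 'rV[R[i]]_n.-1) (g : 'M[R]_n) : R[i] :=
  \prod_(i < n.-1) \prod_(j < n.-1)
    cpow (iwasawa_y g 0 i) ((bcoef i.+1 j.+1)%:R * v 0 j).

(* antidiagonal, with top-right entry (-1)^[n/2] *)
Definition long_w : 'M[R]_n :=
  \matrix_(i, j)
    if (i + j == n.-1)%N then (if i == 0%N :> nat then (-1) ^+ n./2 else 1)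
    else 0.

Fixpoint Ck_on_GL (k : nat) (h : 'M[R]_n -> R) : Prop :=
  (forall g, g \in unitmx -> {for g, continuous h}) /\
  if k is k'.+1 then
    forall i j : 'I_n,
      (forall g, g \in unitmx -> derivable h g (delta_mx i j)) /\
      Ck_on_GL k' (fun g => 'D_(delta_mx i j) h g)
  else True.

Definition smooth_on_GL (f : 'M[R]_n -> R[i]) :=
  forall k, Ck_on_GL k (fun g => complex.Re (f g)) /\
            Ck_on_GL k (fun g => complex.Im (f g)).

(* F is a Borel set of matrices z = x y meeting each orbit of SL(n,Z) on H^n in
   exactly one point *)
Definition fundamental_domain (F : set 'M[R]_n) :=
  [/\ <<s [set U : set 'M[R]_n | open U] >> F,
      (forall z, F z -> exists (x : 'M[R]_n) (y : 'rV[R]_n.-1),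
         [/\ upper_unipotent x, (forall k, 0 < y 0 k) & z = x *m ydiag y]) &
      (forall g, g \in unitmx ->
         exists! z, F z /\
           exists2 a : 'M[int]_n, SLZ a & same_point z (intmx R a *m g))].

(* the integral of a nonnegative function over F for the invariant measure
   d*z = prod_{i<j} dx_{ij} prod_k y_k^{-k(n-k)-1} dy_k *)
Definition invariant_int (F : set 'M[R]_n) (h : 'M[R]_n -> R) : \bar R :=
  iterint [set t : R | 0 < t] (enum 'I_n.-1)
    (fun y =>
       let Y := ydiag (\row_k y k) in
       let jac := \prod_(k < n.-1) y k ^- (k.+1 * (n - k.+1)).+1 in
       iterint setT upos
         (fun x => (\1_F (umx x *m Y) * h (umx x *m Y) * jac)%:E) (fun=> 0))
    (fun=> 1).

End UpperHalfSpace.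

(* The universal enveloping algebra of gl(n,R), by generators and relations:
   formal expressions modulo the least congruence [uea_eq] which makes them an
   associative unital R-algebra in which [UGen] is R-linear and satisfies
   X Y - Y X = [X, Y]. *)
Section EnvelopingAlgebra.
Variables (R : realType) (n : nat).

Inductive uea : Type :=
| UScal of R
| UGen of 'M[R]_n
| UAdd of uea & uea
| UMul of uea & uea.

Inductive uea_eq : uea -> uea -> Prop :=
| ueq_refl a : uea_eq a a
| ueq_sym a b : uea_eq a b -> uea_eq b a
| ueq_trans a b c : uea_eq a b -> uea_eq b c -> uea_eq a c
| ueq_add a a' b b' :
    uea_eq a a' -> uea_eq b b' -> uea_eq (UAdd a b) (UAdd a' b')
| ueq_mul a a' b b' :
    uea_eq a a' -> uea_eq b b' -> uea_eq (UMul a b) (UMul a' b')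
| ueq_addA a b c : uea_eq (UAdd a (UAdd b c)) (UAdd (UAdd a b) c)
| ueq_addC a b : uea_eq (UAdd a b) (UAdd b a)
| ueq_add0 a : uea_eq (UAdd (UScal 0) a) a
| ueq_addN a : uea_eq (UAdd (UMul (UScal (-1)) a) a) (UScal 0)
| ueq_mulA a b c : uea_eq (UMul a (UMul b c)) (UMul (UMul a b) c)
| ueq_mul1 a : uea_eq (UMul (UScal 1) a) a
| ueq_mulDl a b c : uea_eq (UMul (UAdd a b) c) (UAdd (UMul a c) (UMul b c))
| ueq_mulDr a b c : uea_eq (UMul a (UAdd b c)) (UAdd (UMul a b) (UMul a c))
| ueq_scalD x y : uea_eq (UScal (x + y)) (UAdd (UScal x) (UScal y))
| ueq_scalM x y : uea_eq (UScal (x * y)) (UMul (UScal x) (UScal y))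
| ueq_scalC x a : uea_eq (UMul (UScal x) a) (UMul a (UScal x))
| ueq_genL x X Y :
    uea_eq (UGen (x *: X + Y)) (UAdd (UMul (UScal x) (UGen X)) (UGen Y))
| ueq_bracket X Y :
    uea_eq (UMul (UGen X) (UGen Y))
           (UAdd (UMul (UGen Y) (UGen X)) (UGen (X *m Y - Y *m X))).

Definition uea_central (D : uea) := forall E, uea_eq (UMul D E) (UMul E D).

(* (X f)(g) = d/dt f(g + t g X) at t = 0, which is d/dt f(g exp(t X)) at t = 0 *)
Definition lie_deriv (X : 'M[R]_n) (f : 'M[R]_n -> R[i]) (g : 'M[R]_n) : R[i] :=
  'D_(g *m X) (fun h => complex.Re (f h)) g +i*
  'D_(g *m X) (fun h => complex.Im (f h)) g.

Fixpoint uea_act (D : uea) (f : 'M[R]_n -> R[i]) : 'M[R]_n -> R[i] :=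
  match D with
  | UScal c => fun g => c%:C * f g
  | UGen X => lie_deriv X f
  | UAdd D1 D2 => fun g => uea_act D1 f g + uea_act D2 f g
  | UMul D1 D2 => uea_act D1 (uea_act D2 f)
  end.

End EnvelopingAlgebra.

Section MaassForms.
Variables (R : realType) (n : nat).

(* the integral of f(u z) over (SL(n,Z) /\ U) \ U, where U is the group of block
   upper triangular matrices with identity diagonal blocks of sizes r; the
   matrices of U with nontrivial entries in [0,1] form a fundamental domain *)
Definition constant_term (r : seq nat) (f : 'M[R]_n -> R[i]) (z : 'M[R]_n) :
    R[i] :=
  citerint `[0, 1]
    [seq p : 'I_n * 'I_n <- enum {: 'I_n * 'I_n} |
       (reshape_index r p.1 < reshape_index r p.2)%N]
    (fun c => f (umx c *m z)) (fun=> 0).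

Record maass_form (v : 'rV[R[i]]_n.-1) (f : 'M[R]_n -> R[i]) : Prop := {
  mf_right_inv : forall g k c, g \in unitmx -> orthogonal k -> c != 0 ->
    f (c *: (g *m k)) = f g;
  mf_smooth : smooth_on_GL f;
  mf_left_inv : forall (a : 'M[int]_n) g, SLZ a -> g \in unitmx ->
    f (intmx R a *m g) = f g;
  mf_L2 : exists2 F, fundamental_domain F &
    (invariant_int F (fun z => cabs (f z) ^+ 2)%R < +oo)%E;
  mf_eigen : forall D : uea R n, uea_central D ->
    exists2 lambda : R[i],
      (forall g, g \in unitmx -> uea_act D (Ifun v) g = lambda * Ifun v g) &
      (forall g, g \in unitmx -> uea_act D f g = lambda * f g);
  mf_cuspidal : forall r : seq nat,
    all (leq 1) r -> sumn r = n -> (2 <= size r)%N ->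
    forall z, z \in unitmx -> constant_term r f z = 0
}.

Definition hecke_eigenform (f : 'M[R]_n -> R[i]) :=
  forall d : 'M[int]_n, 0 < \det d ->
    exists s (lambda : R[i]), hecke_reps d s /\
      forall z, z \in unitmx ->
        \sum_(c <- s) f (intmx R c *m z) = lambda * f z.

Definition hecke_maass_form (v : 'rV[R[i]]_n.-1) (f : 'M[R]_n -> R[i]) :=
  maass_form v f /\ hecke_eigenform f.

Definition dual_form (f : 'M[R]_n -> R[i]) (z : 'M[R]_n) : R[i] :=
  f (long_w R n *m (invmx z)^T *m long_w R n).

Definition self_dual (f : 'M[R]_n -> R[i]) :=
  forall z, z \in unitmx -> dual_form f z = f z.

End MaassForms.

Section FourierCoefficients.
Variables (R : realType) (n : nat).

(* The superdiagonal entry u_{j.+1}; these are numbered from bottom to top, so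
   the sum has the single term at row n - 2 - j and column n - 1 - j. *)
Definition superdiag (u : 'M[R]_n) (j : 'I_n.-1) : R :=
  \sum_(i < n) \sum_(k < n | (i + j.+2 == n)%N && (k == i.+1 :> nat)) u i k.

Definition psi (a : 'rV[R]_n.-1) (u : 'M[R]_n) : R[i] :=
  expi (2 * pi * \sum_(j < n.-1) a 0 j * superdiag u j).

Definition jacquet_integral (z : 'M[R]_n) (v : 'rV[R[i]]_n.-1)
    (a : 'rV[R]_n.-1) : R[i] :=
  citerint setT (upos n)
    (fun c => Ifun v (long_w R n *m umx c *m z) * conjc (psi a (umx c)))
    (fun=> 0).

(* The integral converges absolutely for Re v_j > 1/n; its analytic continuation
   is the entire function of v which agrees with it there. *)
Definition jacquet_whittaker (z : 'M[R]_n) (v : 'rV[R[i]]_n.-1)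
    (a : 'rV[R]_n.-1) : R[i] :=
  xget (fun=> 0)
    [set Phi : 'rV[R[i]]_n.-1 -> R[i] |
      (forall v', differentiable (Phi : 'rV[R[i]]_n.-1 -> R[i]^o) v') /\
      (forall v' : 'rV[R[i]]_n.-1, (forall j, n%:R^-1 < complex.Re (v' 0 j)) ->
         Phi v' = jacquet_integral z v' a)] v.

(* m_1, ..., m_{n-2} >= 1 and m_{n-1} <> 0 *)
Definition admissible (m : 'rV[int]_n.-1) :=
  forall j : 'I_n.-1, if j.+2 == n then m 0 j != 0 else 0 < m 0 j.

(* (1, ..., 1, m_{n-1} / |m_{n-1}|) *)
Definition sign_char (m : 'rV[int]_n.-1) : 'rV[R]_n.-1 :=
  \row_j (if j.+2 == n then (m 0 j)%:~R / `|(m 0 j)%:~R| else 1).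

Definition fourier_term (v : 'rV[R[i]]_n.-1) (A : 'rV[int]_n.-1 -> R[i])
    (z : 'M[R]_n) (gm : 'M[int]_n.-1 * 'rV[int]_n.-1) : R[i] :=
  let: (g, m) := gm in
  let absm : 'rV[R]_n.-1 := \row_j `|(m 0 j)%:~R| in
  A m / (\prod_(j < n.-1)
           absm 0 j `^ ((j.+1 * (n - j.+1))%:R / 2))%:C *
  jacquet_whittaker (ydiag absm *m intmx R (corner_mx g) *m z) v (sign_char m).

Definition fourier_coefficients (v : 'rV[R[i]]_n.-1) (f : 'M[R]_n -> R[i])
    (A : 'rV[int]_n.-1 -> R[i]) :=
  forall T, U_SL_transversal T -> forall z, z \in unitmx ->
    has_sum [set gm | T gm.1 /\ admissible gm.2] (fourier_term v A z) (f z).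

(* X^n + sum_{j=1}^{n-1} (-1)^j A(1,...,p,...,1) X^(n-j) + (-1)^n *)
Definition satake_poly (A : 'rV[int]_n.-1 -> R[i]) (p : nat) : {poly R[i]} :=
  'X^n +
  \sum_(j < n.-1) ((-1) ^+ j.+1 * A (\row_k (if k == j then p%:Z else 1)))
                    *: 'X^(n - j.+1) +
  ((-1) ^+ n)%:P.

(* alpha p lists the roots of satake_poly A p with multiplicity *)
Definition satake_parameters (A : 'rV[int]_n.-1 -> R[i])
    (alpha : nat -> 'I_n -> R[i]) :=
  forall p, prime p -> satake_poly A p = \prod_(i < n) ('X - (alpha p i)%:P).

Definition power_sum (alpha : nat -> 'I_n -> R[i]) (p r : nat) : R[i] :=
  \sum_(i < n) alpha p i ^+ r.

Definition weak_ramanujan (alpha : nat -> 'I_n -> R[i]) :=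
  exists2 eps : R, 0 < eps &
    forall p (i : 'I_n), prime p -> cabs (alpha p i) <= p%:R `^ (4%:R^-1 - eps).

Definition rudnick_sarnak (alpha : nat -> 'I_n -> R[i]) :=
  forall r : nat, (2 <= r)%N ->
    (\sum_(0 <= p <oo | prime p)
       (cabs (power_sum alpha p r) ^+ 2 * ln (p%:R : R) ^+ 2 / p%:R ^+ r)%R%:E
     < +oo)%E.

End FourierCoefficients.

(* Main.v *)
Require Import Defs.
From mathcomp Require Import all_boot all_order all_algebra.
From mathcomp Require Import all_classical all_reals all_analysis.
From mathcomp Require Import complex.
From mathcomp Require Import lra.

(** Since [|alpha_{p,i}| <= p^(1/4-eps)], the [p]-th term of the series is at
    most [n^2 (log p)^2 p^(-r/2 - 2 r eps)].  For [r >= 2], the bound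
    [log p <= p^eps / eps] turns this into [(n/eps)^2 p^(-(1 + 2 eps))], which is
    summable. *)

Import Order.TTheory GRing.Theory Num.Theory.

Local Open Scope ring_scope.

Section PowerSeries.
Context {R : realType}.
Implicit Types (x d e : R) (k : nat).

(** With [t = 1/(x+1)] one has [x = (x+1)(1-t)], so after factoring out [(x+1)^(-d)] the claim
    becomes the Bernoulli-type inequality [1 + d t <= (1-t)^(-d)]. *)
Lemma powR_telescope {d x} : 0 <= d -> 0 < x ->
  d * (x + 1) `^ (- (1 + d)) <= x `^ (- d) - (x + 1) `^ (- d).
Proof.
move=> d0 x0; have x1 : 0 < x + 1 by lra.
pose t := (x + 1)^-1.
have t0 : 0 < t by rewrite invr_gt0.
have t1 : t < 1 by rewrite invf_lt1 // ltrDr.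
have xE : x = (x + 1) * (1 - t).
  by rewrite mulrBr mulr1 mulfV ?gt_eqF// addrK.
have -> : (x + 1) `^ (- (1 + d)) = t * (x + 1) `^ (- d).
  rewrite opprD powRD; last by rewrite (gt_eqF x1) implybT.
  by rewrite powR_inv1 // ltW.
rewrite {2}xE powRM ?subr_ge0 ?(ltW x1) ?(ltW t1) //.
(* Write the right side as [exp(-d ln(1-t))] and combine [exp y >= 1 + y] with [ln(1-t) <= -t]. *)
have bern : 1 + d * t <= (1 - t) `^ (- d).
  rewrite /powR gt_eqF ?subr_gt0 //.
  apply: le_trans (expR_ge1Dx _).
  rewrite lerD2l mulNr -mulrN ler_wpM2l //.
  by rewrite lerNr le_ln1Dx ?ltrN2.
have y0 := powR_ge0 (x + 1) (- d).
have := ler_wpM2l y0 bern; lra.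
Qed.

(** The terms from index 2 on telescope by [powR_telescope], contributing at most [1/d]; the term at
    1 contributes 1. *)
Lemma sum_powR_le {d} k : 0 < d ->
  \sum_(0 <= i < k) i%:R `^ (- (1 + d)) <= 1 + d^-1.
Proof.
move=> d0.
(* Keeping the telescoped remainder in the bound makes the induction go through. The range ends at
   [k.+2] so that the base case already contains the term at 1. *)
suff H : \sum_(0 <= i < k.+2) i%:R `^ (- (1 + d)) <=
         1 + d^-1 * (1 - k.+1%:R `^ (- d)).
  apply: (@le_trans _ _ (\sum_(0 <= i < k.+2) i%:R `^ (- (1 + d)))).
    by rewrite 2?big_nat_recr //= -addrA lerDl addr_ge0 ?powR_ge0.
  apply: le_trans H _; rewrite lerD2l.
  by rewrite ler_piMr ?invr_ge0 ?(ltW d0) //.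
elim: k => [|k IHk].
  (* The term at index 0 vanishes, since [powR] sends base 0 with nonzero exponent to 0. *)
  rewrite 2?big_nat_recr //= big_geq // powR0; last by lra.
  by rewrite !powR1; lra.
rewrite big_nat_recr //=.
have := @powR_telescope d k.+1%:R (ltW d0) (ltr0Sn _ _).
rewrite natr1 mulrC -ler_pdivlMr // mulrC; lra.
Qed.

Lemma nneseries_powR_lty {d} : 0 < d ->
  (\sum_(0 <= k <oo) (k%:R `^ (- (1 + d)))%:E < +oo)%E.
Proof.
move=> d0; apply: (@le_lt_trans _ _ (1 + d^-1)%:E); last exact: ltry.
apply: lime_le.
  by apply: is_cvg_nneseries => i _ _; rewrite lee_fin powR_ge0.
by apply: nearW => k; rewrite sumEFin lee_fin sum_powR_le.
Qed.

(** Apply [ln y < y] to [y = x^e]. *)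
Lemma ln_le_powR {e x} : 0 < e -> 0 < x -> ln x <= x `^ e / e.
Proof.
move=> e0 x0; rewrite ler_pdivlMr // mulrC -ln_powR.
by apply: ltW; apply: ln_sublinear; apply: powR_gt0.
Qed.

End PowerSeries.

Lemma cabs_ge0 (R : realType) (z : R[i]) : 0 <= cabs z.
Proof. by case: z => a b; apply: sqrtr_ge0. Qed.

Lemma cabsX (R : realType) (z : R[i]) k : cabs (z ^+ k) = cabs z ^+ k.
Proof.
elim: k => [|k IHk]; first by rewrite !expr0; apply: Normc.normc1.
by rewrite !exprS -IHk; apply: Normc.normcM.
Qed.

Lemma cabs_sum_le (R : realType) (I : Type) (s : seq I) (P : pred I)
    (F : I -> R[i]) :
  cabs (\sum_(i <- s | P i) F i) <= \sum_(i <- s | P i) cabs (F i).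
Proof.
elim/big_rec2: _ => [|i x y _ xy]; first by rewrite /cabs Normc.normc0.
by apply: le_trans (le_normcD _ _) _; rewrite lerD2l.
Qed.

Lemma cabs_power_sum_le (R : realType) (n : nat) (alpha : nat -> 'I_n -> R[i])
    (p r : nat) (B : R) :
  (forall i, cabs (alpha p i) <= B) ->
  cabs (power_sum alpha p r) <= n%:R * B ^+ r.
Proof.
move=> aB; apply: le_trans (cabs_sum_le _ _ _ _ _) _.
apply: (@le_trans _ _ (\sum_(i < n) B ^+ r)).
  apply: ler_sum => i _; rewrite cabsX lerXn2r ?nnegrE ?cabs_ge0 //.
  (* [B] is nonnegative because it bounds a modulus. *)
  exact: le_trans (cabs_ge0 _ _) (aB i).
by rewrite sumr_const card_ord mulr_natl.
Qed.

Lemma rudnick_sarnak_term_le (R : realType) (n : nat)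
    (alpha : nat -> 'I_n -> R[i]) (p r : nat) (e : R) :
  0 < e -> (0 < p)%N -> (2 <= r)%N ->
  (forall i, cabs (alpha p i) <= p%:R `^ (4%:R^-1 - e)) ->
  cabs (power_sum alpha p r) ^+ 2 * ln (p%:R : R) ^+ 2 / p%:R ^+ r <=
  (n%:R / e) ^+ 2 * p%:R `^ (- (1 + 2 * e)).
Proof.
move=> e0 p_gt0 r2 ha.
have p0 : 0 < p%:R :> R by rewrite ltr0n.
have p1 : 1 <= p%:R :> R by rewrite ler1n.
have r2R : 2 <= r%:R :> R by rewrite ler_nat.
have pD x y : p%:R `^ (x + y) = p%:R `^ x * p%:R `^ y :> R.
  by rewrite powRD // (gt_eqF p0) implybT.
have pX x k : (p%:R `^ x) ^+ k = p%:R `^ (x * k%:R) :> R.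
  by rewrite -powR_mulrn ?powR_ge0 // -powRrM.
have hs := cabs_power_sum_le _ _ _ _ r _ ha.
have hl := ln_le_powR e0 p0.
have s2 : cabs (power_sum alpha p r) ^+ 2 <=
          n%:R ^+ 2 * p%:R `^ ((4^-1 - e) * r%:R * 2).
  rewrite -[_ * 2]mulrA -natrM -pX exprM -exprMn.
  by rewrite lerXn2r // ?nnegrE ?cabs_ge0.
(* The squared logarithm costs [p^(2e)], half of the saving [p^(4e)] available when [r = 2]. *)
have l2 : ln (p%:R : R) ^+ 2 <= e^-1 ^+ 2 * p%:R `^ (e * 2).
  rewrite -[e * 2]/(e * 2%:R) -pX -exprMn [e^-1 * _]mulrC.
  by rewrite lerXn2r // nnegrE ?ln_ge0 // divr_ge0 ?powR_ge0 // ltW.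
rewrite -(powR_mulrn r (ltW p0)) -powRN.
apply: (@le_trans _ _ (n%:R ^+ 2 * p%:R `^ ((4^-1 - e) * r%:R * 2) *
    (e^-1 ^+ 2 * p%:R `^ (e * 2)) * p%:R `^ (- r%:R))).
  by rewrite ler_wpM2r ?powR_ge0 // ler_pM // sqr_ge0.
rewrite exprMn mulrACA -!mulrA -!pD !mulrA ler_wpM2l //.
  by rewrite !divr_ge0 ?mulr_ge0 ?(ltW e0).
(* As [p >= 1], it suffices to compare exponents: [-(1+2e)] minus [2r(1/4-e) + 2e - r] equals
   [(r-2)(1/2+2e)], which is nonnegative for [r >= 2]. *)
apply: ler_powR => //; nra.
Qed.

Theorem theorem1p1 (R : realType) (n : nat) (hn : (2 <= n)%N)
    (v : 'rV[R[i]]_n.-1) (f : 'M[R]_n -> R[i])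
    (hf : hecke_maass_form v f) (hsd : self_dual f)
    (A : 'rV[int]_n.-1 -> R[i]) (hA : fourier_coefficients v f A)
    (hA1 : A (const_mx 1) = 1)
    (alpha : nat -> 'I_n -> R[i]) (halpha : satake_parameters A alpha)
    (hram : weak_ramanujan alpha) :
  rudnick_sarnak alpha.
Proof.
case: hram => e e0 ha r r2.
have e20 : 0 < 2 * e by rewrite mulr_gt0.
pose u k : \bar R := (k%:R `^ (- (1 + 2 * e)))%:E.
have u0 k : (0 <= u k)%E by rewrite lee_fin powR_ge0.
apply: (@le_lt_trans _ _
  (\sum_(0 <= p <oo | prime p) (((n%:R / e) ^+ 2)%:E * u p))%E).
  apply: lee_nneseries => [p _ _|p p_pr].
    by rewrite lee_fin -exprMn divr_ge0 ?sqr_ge0 ?exprn_ge0.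
  rewrite lee_fin; apply: rudnick_sarnak_term_le => // [|i].
    exact: prime_gt0.
  exact: ha.
rewrite nneseriesZl //.
apply: lte_mul_pinfty; rewrite ?lee_fin ?sqr_ge0 //.
(* The terms [u k] are nonnegative, so the sum over primes is at most the sum over all natural
   numbers. *)
apply: le_lt_trans (nneseries_powR_lty e20).
exact: subset_lee_nneseries.
Qed.
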